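(* Let $Y(s_1,\dots,s_n)$ be a Gaussian field with $\mathsf{E}[Y(s_1,\dots,s_n)]=0$ for all $(s_1,\dots,s_n)\in[0,\infty)^n$, and covariance function $$\mathsf{E}\bigl[Y(s_1,\dots,s_n)Y(t_1,\dots,t_n)\bigr]=\prod_{i=1}^{n}u_i(s_i\wedge t_i)\,v_i(s_i\vee t_i)$$ for all $(s_1,\dots,s_n),(t_1,\dots,t_n)\in[0,\infty)^n$, where $u_i,v_i$, $i=1,\dots,n$, are functions of one variable. If the functions $a_i(t)=\dfrac{u_i(t)}{v_i(t)}$, $i=1,\dots,n$, are increasing and continuous, then the field $$Z(t_1,\dots,t_n)=\frac{Y\bigl(a_1^{-1}(t_1),\dots,a_n^{-1}(t_n)\bigr)}{v_1\bigl(a_1^{-1}(t_1)\bigr)\cdots v_n\bigl(a_n^{-1}(t_n)\bigr)}$$ is stochastically equivalent to the Brownian sheet $X(t_1,\dots,t_n)$, where $a_i^{-1}(\cdot)$, $i=1,\dots,n$, denotes the inverse of $a_i(\cdot)$.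
   Context: $\wedge$ denotes minimum and $\vee$ denotes maximum. Let $K=[0,1]^n$. A real-valued separable Gaussian stochastic process $\{X(s_1,\dots,s_n),\ (s_1,\dots,s_n)\in K\}$ is called a Brownian sheet with $n$ parameters if (1) $X(s_1,\dots,s_n)=0$ whenever $s_1\cdots s_n=0$; (2) $\mathsf{E}[X(s_1,\dots,s_n)]=0$ for all $(s_1,\dots,s_n)\in K$; (3) $\mathsf{E}[X(s_1,\dots,s_n)X(t_1,\dots,t_n)]=\prod_{i=1}^n\min\{s_i,t_i\}$ for all $(s_1,\dots,s_n),(t_1,\dots,t_n)\in K$. Processes $\xi(t)$ and $\xi^*(t)$ (and likewise fields, with $t$ a multidimensional parameter) with parameter set $T$ are said to be stochastically equivalent if $\mathsf{P}\{\xi(t)=\xi^*(t)\}=1$ for all $t\in T$.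
   Formalization: Made explicit: each v_i is nonzero on [0,∞), ''increasing'' is strict, and the range of each a_i on [0,∞) contains [0,1], without which Z is undefined on [0,1]^n (e.g. u=e^t, v=e^{-t}); equivalence means P(Z(t)=X(t))=1 for each t in [0,1]^n, for some Brownian sheet X on the same space. *)

(* Defs.v *)
From HB Require Import structures.
From mathcomp Require Import all_boot all_order all_algebra.
From mathcomp Require Import all_classical all_reals all_analysis.

Set Implicit Arguments.
Unset Strict Implicit.
Unset Printing Implicit Defensive.

Import Order.TTheory GRing.Theory Num.Theory.
Import numFieldTopology.Exports.

Local Open Scope classical_set_scope.
Local Open Scope ring_scope.

Definition unit_cube (R : realType) (n : nat) : set 'rV[R]_n :=
  [set t | forall i, 0 <= t ord0 i <= 1].

Definition orthant (R : realType) (n : nat) : set 'rV[R]_n :=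
  [set t | forall i, 0 <= t ord0 i].

(* Degenerate laws count as Gaussian.  They need a separate case because
   [normal_prob m 0] is the uniform law on [0, 1], not the point mass at m. *)
Definition gaussian_var (R : realType) (d : measure_display)
    (T : measurableType d) (P : probability T R) (X : T -> R) : Prop :=
  measurable_fun [set: T] X /\
  exists m s : R, 0 <= s /\
    forall B : set R, measurable B ->
      pushforward P X B = if s == 0 then \d_m B else normal_prob m s B.

(* The vectors (X t_1, ..., X t_k), with all t_j in D, are Gaussian: every
   linear combination of their components is a Gaussian variable.  The random
   variables X t with t outside D are irrelevant. *)
Definition gaussian_field (R : realType) (d : measure_display)
    (T : measurableType d) (P : probability T R) (E : Type) (D : set E)
    (X : E -> {RV P >-> R}) : Prop :=
  forall (k : nat) (t : 'I_k -> E) (c : 'I_k -> R),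
    (forall j, D (t j)) ->
    gaussian_var P (fun w => \sum_(j < k) c j * X (t j) w).

(* Separability in the sense of Doob, with respect to closed sets: outside one
   null set N, for all open G and closed F, the events
   {X t in F for all t in G /\ S} and {X t in F for all t in G /\ D} agree
   (one inclusion is immediate from S `<=` D). *)
Definition separable_process (R : realType) (d : measure_display)
    (T : measurableType d) (P : probability T R) (E : topologicalType)
    (D : set E) (X : E -> {RV P >-> R}) : Prop :=
  exists (S : set E) (N : set T),
    [/\ countable S, S `<=` D, D `<=` closure S, P.-negligible N &
      forall w, ~ N w ->
      forall (G : set E) (F : set R), open G -> closed F ->
        (forall t, (G `&` S) t -> F (X t w)) ->
        forall t, (G `&` D) t -> F (X t w)].

Definition brownian_sheet (R : realType) (d : measure_display)
    (T : measurableType d) (P : probability T R) (n : nat)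
    (X : 'rV[R]_n -> {RV P >-> R}) : Prop :=
  let K := @unit_cube R n in
  [/\ separable_process K X,
      gaussian_field K X,
      (forall s, K s -> \prod_(i < n) s ord0 i = 0 -> forall w, X s w = 0),
      (forall s, K s -> 'E_P[X s]%E = 0%E) &
      (forall s t, K s -> K t ->
        'E_P[(fun w => X s w * X t w)%R]%E =
        (\prod_(i < n) Num.min (s ord0 i) (t ord0 i))%:E)].

Definition stochastically_equivalent (R : realType) (d : measure_display)
    (T : measurableType d) (P : probability T R) (E : Type) (D : set E)
    (X X' : E -> T -> R) : Prop :=
  forall t, D t -> P [set w | X t w = X' t w] = 1%E.

Definition inverse_nonneg (R : realType) (a : R -> R) : R -> R :=
  'pinv_(fun=> 0) `[0, +oo[%classic a.

Definition transformed_field (R : realType) (d : measure_display)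
    (T : measurableType d) (P : probability T R) (n : nat)
    (Y : 'rV[R]_n -> {RV P >-> R}) (v a : 'I_n -> R -> R) :
    'rV[R]_n -> T -> R :=
  fun t w =>
    Y (\row_i inverse_nonneg (a i) (t ord0 i)) w /
    \prod_(i < n) v i (inverse_nonneg (a i) (t ord0 i)).

(* Main.v *)
Require Import Defs.
From HB Require Import structures.
From mathcomp Require Import all_boot all_order all_algebra.
From mathcomp Require Import all_classical all_reals all_analysis.
From mathcomp Require Import measurable_realfun zify ring lra.

Set Implicit Arguments.
Unset Strict Implicit.
Unset Printing Implicit Defensive.

Import Order.TTheory GRing.Theory Num.Theory.
Import numFieldTopology.Exports.

Local Open Scope classical_set_scope.
Local Open Scope ring_scope.

(** The inverses of the [a i] carry the unit cube into the orthant, and there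
    [u (min x y) * v (max x y) / (v x * v y) = min (a x) (a y)] because [a] is
    monotone: the transformed field is centred, Gaussian and has the covariance
    of the Brownian sheet ([transformed_sheet_law]).  It may fail to be
    separable and to vanish identically on the coordinate hyperplanes, so the
    real work is to find, for a field [Z] with this law, a modification [X]
    with both properties ([brownian_sheet_modification]).

    The modification is a chaining construction in the manner of
    Kolmogorov-Chentsov.  Let [t_m] be [t] with its coordinates rounded down to
    multiples of [16^-m].  The increment [Z t_(m+1) - Z t_m] is Gaussian with
    second moment at most [n * 16^-m] ([sheet_increment_moment]).  All Gaussian
    tails being controlled by the second moment ([gaussian_tail]), it exceeds
    [2^-m] with probability at most [C_k * 4^-(k m)] for every [k].  There are
    about [16^(n m)] grid points of level [m + 1], so the choice [k = 2 n + 1]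
    makes the union bound summable, and by Borel-Cantelli there is one null set
    outside of which, for all [t] at once, the increments are eventually below
    [2^-m].  Outside this set [X t] is the limit of [Z t_m]; on it [X] is 0.

    Separability then needs no continuity of paths: [X] agrees with [Z] at the
    grid points, so each [X t] is by construction a limit of values of [X] at
    grid points converging to [t].  The same tail bound at a fixed [t] gives
    [Z t_m --> Z t] almost surely, whence [X t = Z t] almost surely.  Finally
    [X] vanishes identically on the hyperplanes if [Z] does, since rounding
    down keeps a zero coordinate; this can be assumed because [Z s] has second
    moment 0 there. *)

(** * Gaussian tails controlled by the second moment *)

Section normal_estimates.
Context {R : realType}.
Implicit Types m s q x y r : R.

(** Compares the densities centred at [m] and at [m'], whose ratio on [A] is at
    most the exponential factor.  This gives Gaussian tails without computing
    any integral. *)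
Lemma normal_prob_shift_le m m' s x (A : set R) : s != 0 -> measurable A ->
  (forall y, A y -> (y - m') ^+ 2 + x ^+ 2 <= (y - m) ^+ 2) ->
  (normal_prob m s A <= (expR (- (x ^+ 2 / (s ^+ 2 *+ 2))))%:E)%E.
Proof.
move=> s0 mA hA; set e := expR _.
have s2 : 0 < s ^+ 2 *+ 2 by rewrite pmulrn_lgt0// exprn_even_gt0.
apply: (@le_trans _ _ (e%:E * normal_prob m' s A)%E); last first.
  rewrite -[leRHS]mule1 lee_wpmul2l ?lee_fin ?expR_ge0//.
  exact: probability_le1.
rewrite /normal_prob -ge0_integralZl//=; last 3 first.
- apply/measurable_EFinP; apply: measurable_funTS.
  exact: measurable_normal_pdf.
- by move=> y _; rewrite lee_fin normal_pdf_ge0.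
- by rewrite lee_fin expR_ge0.
apply: ge0_le_integral => //=.
- by move=> y _; rewrite lee_fin normal_pdf_ge0.
- apply/measurable_EFinP; apply: measurable_funTS.
  exact: measurable_normal_pdf.
- apply/measurable_EFinP; apply: measurable_funM => //.
  apply: measurable_funTS; exact: measurable_normal_pdf.
move=> y Ay; rewrite -EFinM lee_fin !normal_pdfE// mulrCA.
(* After cancelling the common peak, the hypothesis compares exponents. *)
rewrite ler_wpM2l ?normal_peak_ge0// /normal_fun -expRD ler_expR.
rewrite !mulNr -opprD -mulrDl lerN2 ler_pM2r ?invr_gt0// addrC.
exact: hA.
Qed.

(** The density is at most [1 / (2 s)], because [pi >= 2]: a normal law that is
    concentrated on a short interval has a small standard deviation. *)
Lemma normal_prob_itv_le m s r : 0 < s -> 0 <= r ->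
  (normal_prob m s [set` `[- r, r]%R] <= (r / s)%:E)%E.
Proof.
move=> s0 r0; have sn0 : s != 0 by rewrite gt_eqF.
have peak : normal_peak s <= (2 * s)^-1.
  have s2 : 0 <= 2 * s by rewrite mulr_ge0// ltW.
  rewrite lef_pV2 ?posrE ?mulr_gt0//; last first.
    by rewrite sqrtr_gt0 pmulrn_lgt0// mulr_gt0 ?pi_gt0 ?exprn_gt0.
  rewrite -[leLHS](ger0_norm s2) -sqrtr_sqr ler_wsqrtr// exprMn.
  by have := @pi_ge2 R; have := sqr_ge0 s; rewrite -mulr_natr; nra.
rewrite /normal_prob; apply: (@le_trans _ _
    (\int[lebesgue_measure]_(x in [set` `[- r, r]%R]) (normal_peak s)%:E)%E).
  apply: ge0_le_integral => //=.
  - by move=> y _; rewrite lee_fin normal_pdf_ge0.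
  - apply/measurable_EFinP; apply: measurable_funTS.
    exact: measurable_normal_pdf.
  - by move=> y _; rewrite lee_fin normal_pdf_ub.
rewrite integral_cst//= lebesgue_measure_itv/= lte_fin.
case: ifPn => [_|_]; last by rewrite mule0 lee_fin divr_ge0// ltW.
rewrite -EFinB -EFinM lee_fin opprK.
apply: (@le_trans _ _ ((2 * s)^-1 * (r + r))).
  by rewrite ler_wpM2r// addr_ge0.
by rewrite le_eqVlt; apply/orP; left; apply/eqP; field.
Qed.

Lemma expRN_le_fact_div k (z : R) : 0 < z -> expR (- z) <= k`!%:R / z ^+ k.
Proof.
move=> z0; rewrite expRN -[leRHS]invrK invf_div lef_pV2 ?posrE ?expR_gt0//.
  case: k => [|k].
    by rewrite expr0 fact0 divr1 -[leLHS]expR0 ler_expR ltW.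
  by rewrite (le_trans _ (expR_ge1Dxn k (ltW z0)))// lerDr.
by rewrite divr_gt0 ?exprn_gt0 ?ltr0n ?fact_gt0.
Qed.

Lemma normal_prob_out_le m s x r : 0 < s -> 0 <= r -> `|m| <= x ->
  (normal_prob m s (~` [set` `]- (x + r), x + r[%R]) <=
   2%:E * (expR (- (r ^+ 2 / (s ^+ 2 *+ 2))))%:E)%E.
Proof.
move=> s0 r0; rewrite ler_norml => /andP[mx1 mx2].
have sn0 : s != 0 by rewrite gt_eqF.
have -> : ~` `]- (x + r), x + r[%classic =
    `]-oo, - (x + r)]%classic `|` `[x + r, +oo[%classic.
  apply/seteqP; split => y /=; rewrite !in_itv/= andbT.
    move/negP; rewrite negb_and -!leNgt => /orP[]; by [left|right].
  by move=> [yx|yx]; apply/negP; rewrite negb_and -!leNgt yx ?orbT.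
apply: (le_trans (measureU2 _ _ _)) => //=.
have -> : (2%:E = 1 + 1 :> \bar R)%E by [].
rewrite ge0_muleDl// !mul1e; apply: leeD.
  apply: (@normal_prob_shift_le m (m - r)) => // y /=; rewrite in_itv/= => yx.
  nra.
apply: (@normal_prob_shift_le m (m + r)) => // y /=.
by rewrite in_itv/= andbT => yx; nra.
Qed.

(** For such [x] the bound of [normal_prob_tail_le] and [gaussian_tail] is
    trivial, which lets those lemmas hold for every positive [x]. *)
Lemma tail_bound_ge1 k q x : 0 < q -> 0 < x -> x <= 16 * q ->
  1 <= 2 * 256 ^+ k * k`!%:R * (q / x) ^+ (2 * k).
Proof.
move=> q0 x0 xq.
have facge1 : (1 : R) <= k`!%:R by rewrite ler1n fact_gt0.
have : 1 <= 256 ^+ k * (q / x) ^+ (2 * k).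
  rewrite exprM -exprMn exprn_ege1//.
  have : 1 <= 16 * (q / x) by rewrite mulrA ler_pdivlMr// mul1r.
  nra.
by move=> h; rewrite -mulrA mulrCA mulrA mulrC; nra.
Qed.

(** The mean and the deviation are not given but recovered from the mass near
    0: as [ `]- 2 q, 2 q[ ] has mass at least [3 / 4], the density bound forces
    [s <= 3 q], and a mean beyond [8 q] would leave that interval in a tail of
    mass at most [expR (- 2)].  Beyond [16 q] the tail around 0 is then one
    around [m], at half the distance. *)
Lemma normal_prob_tail_le m s q x k : 0 < s -> 0 < q -> 0 < x ->
  (normal_prob m s (~` [set` `]- (2 * q), (2 * q)[%R]) <= (4^-1)%:E)%E ->
  (normal_prob m s (~` [set` `]- x, x[%R]) <=
   (2 * 256 ^+ k * k`!%:R * (q / x) ^+ (2 * k))%:E)%E.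
Proof.
move=> s0 q0 x0 hq; have sn0 : s != 0 by rewrite gt_eqF.
have [xq|qx] := leP x (16 * q).
  apply: (@le_trans _ _ 1%E); last by rewrite lee_fin tail_bound_ge1.
  by apply: probability_le1; exact: measurableC.
have Pm (A : set R) : measurable A ->
    (normal_prob m s A + normal_prob m s (~` A) = 1)%E.
  by move=> mA; rewrite probability_setC// addeC subeK ?fin_num_measure.
pose I : set R := [set` `]- (2 * q), (2 * q)[%R].
have mI : measurable I by exact: measurable_itv.
have lo : ((3 / 4)%:E <= normal_prob m s I)%E.
  rewrite -(leeD2rE (x := normal_prob m s (~` I))) ?Pm//.
    by rewrite (le_trans (leeD2l _ hq))// -EFinD lee_fin; lra.
  by rewrite fin_num_measure//; apply: measurableC.
have sq : s <= 3 * q.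
  have : ((3 / 4)%:E <= (2 * q / s)%:E :> \bar R)%E.
    apply: (le_trans lo); apply: le_trans (normal_prob_itv_le m s0 _) => //.
      apply: le_measure; rewrite ?inE// => y /=; rewrite !in_itv/=.
      by move=> /andP[/ltW-> /ltW->].
    by rewrite mulr_ge0// ltW.
  by rewrite lee_fin ler_pdivlMr//; lra.
have e2 : expR (- 2) <= 3^-1 :> R.
  by rewrite expRN lef_pV2 ?posrE ?expR_gt0// (le_trans _ (expR_ge1Dx _)).
have mq : `|m| <= 8 * q.
  rewrite leNgt; apply/negP => qm.
  suff [m'] : exists m', forall y, - (2 * q) < y < 2 * q ->
      (y - m') ^+ 2 + (6 * q) ^+ 2 <= (y - m) ^+ 2.
    (* With [s <= 3 q] the exponent [(6 q)^2 / (2 s^2)] is at least 2. *)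
    move=> /(@normal_prob_shift_le m m' s (6 * q) I sn0).
    move=> /(_ mI)/(le_trans lo); rewrite lee_fin => he.
    suff : expR (- ((6 * q) ^+ 2 / (s ^+ 2 *+ 2))) <= expR (- 2) by lra.
    rewrite ler_expR lerN2 ler_pdivlMr; last first.
      by rewrite pmulrn_lgt0// exprn_gt0.
    rewrite -mulr_natr; nra.
  move: qm; rewrite ltr_normr => /orP[] qm.
    by exists (m - 6 * q) => y /andP[y1 y2]; nra.
  by exists (m + 6 * q) => y /andP[y1 y2]; nra.
(* Since [8 q <= x / 2], points outside [ `]- x, x[ ] are at least [x / 2]
   away from [m]. *)
apply: le_trans
  (_ : _ <= 2%:E * (expR (- ((x / 2) ^+ 2 / (s ^+ 2 *+ 2))))%:E)%E _.
  apply: le_trans (normal_prob_out_le s0 _ mq) => //; last first.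
    by rewrite divr_ge0// ltW.
  apply: le_measure; rewrite ?inE//; [exact: measurableC|exact: measurableC|].
  by apply: subsetC => y /=; rewrite !in_itv/= => /andP[? ?]; lra.
set z := (x / 2) ^+ 2 / (s ^+ 2 *+ 2).
have z0 : 0 < z.
  by rewrite divr_gt0 ?exprn_gt0 ?divr_gt0// pmulrn_lgt0 ?exprn_gt0.
rewrite -EFinM lee_fin -!mulrA ler_wpM2l//.
apply: le_trans (expRN_le_fact_div k z0) _.
rewrite mulrCA ler_wpM2l// exprM -exprMn -exprVn lerXn2r ?nnegrE//.
- by rewrite invr_ge0 ltW.
- by rewrite mulr_ge0 ?sqr_ge0.
have -> : z^-1 = 8 * (s / x) ^+ 2.
  by rewrite /z -mulr_natr; field; rewrite gt_eqF.
have : s / x <= 3 * (q / x) by rewrite mulrA ler_pM2r// invr_gt0.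
have : 0 <= s / x by rewrite divr_ge0// ltW.
nra.
Qed.

End normal_estimates.

Section gaussian_variables.
Context {d : measure_display} {T : measurableType d} {R : realType}.
Context {P : probability T R}.
Implicit Types (X Y : {RV P >-> R}) (q x r : R).

(** Chebyshev's inequality, not centred at the mean. *)
Lemma second_moment_tail X x r : 0 < x ->
  ('E_P[(fun w => X w * X w)%R] <= r%:E)%E ->
  (P [set w | (x <= `|X w|)%R] <= (r / x ^+ 2)%:E)%E.
Proof.
move=> x0 hr; rewrite mulrC EFinM lee_pdivlMl ?exprn_gt0//.
apply: le_trans hr.
have := @markov _ _ _ P X (fun y => y ^+ 2) x x0.
move=> /(_ _ _ _)/le_trans-> //.
- by move=> y _; rewrite sqr_ge0.
- by move=> y z; rewrite !nnegrE => y0 z0; rewrite ler_sqr.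
- rewrite le_eqVlt; apply/orP; left; apply/eqP; congr expectation.
  by apply/funext => w /=; rewrite real_normK ?num_real// expr2.
Qed.

(** The constant depends on [k] only, and the exponent is as large as one likes:
    this is the one Gaussian fact that the chaining argument needs.  Chebyshev's
    inequality gives the mass near 0, which determines the law well enough. *)
Lemma gaussian_tail X q x k : gaussian_var P X -> 0 < q -> 0 < x ->
  ('E_P[(fun w => X w * X w)%R] <= (q ^+ 2)%:E)%E ->
  (P [set w | (x <= `|X w|)%R] <=
   (2 * 256 ^+ k * k`!%:R * (q / x) ^+ (2 * k))%:E)%E.
Proof.
move=> [mX [m [s [s0 lawX]]]] q0 x0 X2.
have tailE y : 0 < y -> P [set w | (y <= `|X w|)%R] =
    pushforward P X (~` [set` `]- y, y[%R]).
  move=> y0; rewrite /pushforward; congr (P _); apply/seteqP; split => w /=.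
    by rewrite in_itv/= -ltr_norml => h; apply/negP; rewrite -leNgt.
  by rewrite in_itv/= -ltr_norml => /negP; rewrite -leNgt.
have itvM y : measurable (~` [set` `]- y, y[%R] : set R).
  exact: measurableC.
have hq : (P [set w | (2 * q <= `|X w|)%R] <= (4^-1)%:E)%E.
  apply: le_trans (second_moment_tail _ X2) _; first by rewrite mulr_gt0.
  rewrite lee_fin exprMn invfM mulrCA divff ?mulr1; first by lra.
  by rewrite expf_neq0// gt_eqF.
rewrite tailE// lawX//; rewrite tailE ?mulr_gt0// lawX// in hq.
case: eqVneq hq => [_|sn0] hq; last first.
  by apply: normal_prob_tail_le => //; rewrite lt_neqAle eq_sym sn0.
(* The degenerate law: a point mass at some [m], which lies near 0. *)
have mq : - (2 * q) < m < 2 * q.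
  move: hq; rewrite diracE.
  have [_|] := boolP (m \in _); first by rewrite lee_fin/=; lra.
  by rewrite notin_setE /= in_itv/= => /contrapT.
have [xq|qx] := leP x (16 * q).
  apply: (@le_trans _ _ 1%E); last by rewrite lee_fin tail_bound_ge1.
  by apply: probability_le1; exact: measurableC.
rewrite diracE memNset ?lee_fin; last first.
  case/andP: mq => mq1 mq2; rewrite /= in_itv/=; apply.
  apply/andP; split; lra.
by rewrite !mulr_ge0 ?exprn_ge0 ?divr_ge0 ?ltW.
Qed.

End gaussian_variables.

(** * Second moments and almost sure equality *)

Section second_moments.
Context {d : measure_display} {T : measurableType d} {R : realType}.
Context {P : probability T R}.
Implicit Types (X Y : {RV P >-> R}).

(** Hypotheses in this form, a second moment equal to a real number, carry the
    integrability that linearity of the expectation asks for. *)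
Lemma sqr_Lfun1 X a : 'E_P[(fun w => X w * X w)%R]%E = a%:E ->
  (fun w => X w * X w) \in Lfun P 1.
Proof.
move=> Xa; apply/Lfun1_integrable/integrableP; split.
  by apply/measurable_EFinP; apply: measurable_funM.
rewrite (eq_integral (fun w => (X w * X w)%:E)) => [|w _ /=].
  by move: Xa; rewrite unlock => ->; rewrite ltry.
by rewrite ger0_norm// -expr2 sqr_ge0.
Qed.

Lemma mul_Lfun1 X Y a c :
  'E_P[(fun w => X w * X w)%R]%E = a%:E ->
  'E_P[(fun w => Y w * Y w)%R]%E = c%:E ->
  (fun w => X w * Y w) \in Lfun P 1.
Proof.
move=> /sqr_Lfun1 X2 /sqr_Lfun1 Y2.
have /Lfun1_integrable XY2 :
    (fun w => X w * X w) \+ (fun w => Y w * Y w) \in Lfun P 1.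
  by apply: rpredD.
apply/Lfun1_integrable; apply: le_integrable XY2 => //.
  by apply/measurable_EFinP; apply: measurable_funM.
move=> w _ /=; rewrite lee_fin.
apply: (@le_trans _ _ (X w * X w + Y w * Y w)); last exact: ler_norm.
rewrite -!expr2 -(real_normK (num_real (X w))) -(real_normK (num_real (Y w))).
have := sqr_ge0 (`|X w| - `|Y w|); have := normr_ge0 (X w).
by have := normr_ge0 (Y w); rewrite normrM; nra.
Qed.

Lemma sqr_Lfun1_Lfun1 X a : 'E_P[(fun w => X w * X w)%R]%E = a%:E ->
  (X : T -> R) \in Lfun P 1.
Proof.
move=> Xa; have := @mul_Lfun1 X (cst 1) a 1 Xa.
rewrite (_ : (fun w => X w * _) = X); last first.
  by apply/funext => w /=; rewrite mulr1.
apply; rewrite -(expectation_cst P 1); congr expectation.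
by apply/funext => w /=; rewrite mulr1.
Qed.

Lemma second_momentB X Y a b c :
  'E_P[(fun w => X w * X w)%R]%E = a%:E ->
  'E_P[(fun w => X w * Y w)%R]%E = b%:E ->
  'E_P[(fun w => Y w * Y w)%R]%E = c%:E ->
  'E_P[(fun w => (X w - Y w) * (X w - Y w))%R]%E = (a - 2 * b + c)%:E.
Proof.
move=> Xa XYb Yc.
have XX := sqr_Lfun1 Xa; have YY := sqr_Lfun1 Yc.
have XY := mul_Lfun1 Xa Yc.
rewrite (_ : (fun w => (X w - Y w) * (X w - Y w)) =
  (((fun w => X w * X w) \- (2 \o* (fun w => X w * Y w))) \+
    (fun w => Y w * Y w))%R); last first.
  by apply/funext => w /=; ring.
have XY2 : (2 \o* (fun w => X w * Y w))%R \in Lfun P 1 by apply: Lfun_scale.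
rewrite expectationD ?expectationB ?expectationZl//; last exact: rpredB.
by rewrite Xa XYb Yc.
Qed.

Lemma eq_ae_probability (f g : T -> R) (B : set R) :
  measurable_fun [set: T] f -> measurable_fun [set: T] g -> measurable B ->
  {ae P, forall w, f w = g w} -> P (f @^-1` B) = P (g @^-1` B).
Proof.
move=> mf mg mB fg.
have mfB : measurable (f @^-1` B) by rewrite -[f @^-1` _]setTI; exact: mf.
have mgB : measurable (g @^-1` B) by rewrite -[g @^-1` _]setTI; exact: mg.
rewrite -[f @^-1` B]setIT -[g @^-1` B]setIT -!integral_indic//.
apply: ae_eq_integral => //; [exact/measurable_EFinP|exact/measurable_EFinP|].
apply: filterS fg => w fgw _; rewrite !indicE.
rewrite (_ : (w \in f @^-1` B) = (w \in g @^-1` B))//.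
by apply/idP/idP; rewrite !inE /= fgw.
Qed.

Lemma gaussian_var_ae (f g : T -> R) : measurable_fun [set: T] f ->
  {ae P, forall w, f w = g w} -> gaussian_var P g -> gaussian_var P f.
Proof.
move=> mf fg [mg [m [s [s0 lawg]]]]; split => //.
exists m, s; split => // B mB; rewrite -lawg//.
exact: eq_ae_probability.
Qed.

Lemma expectation_ae (f g : T -> R) :
  measurable_fun [set: T] f -> measurable_fun [set: T] g ->
  {ae P, forall w, f w = g w} -> 'E_P[f]%E = 'E_P[g]%E.
Proof.
move=> mf mg fg; rewrite unlock; apply: ae_eq_integral => //.
- exact/measurable_EFinP.
- exact/measurable_EFinP.
- by apply: filterS fg => w -> _.
Qed.

Lemma probability_eq1_ae X Y :
  P [set w | X w = Y w] = 1%E <-> {ae P, forall w, X w = Y w}.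
Proof.
have mXY : measurable [set w | X w = Y w].
  rewrite (_ : [set w | _] = (X \- Y)%R @^-1` [set 0]).
    by rewrite -[_ @^-1` _]setTI; apply: measurable_funB.
  apply/seteqP; split => w /=; first by move=> ->; rewrite subrr.
  by move/eqP; rewrite subr_eq0 => /eqP.
split=> [XY1|XYae].
  exists (~` [set w | X w = Y w]); split => //.
    exact: measurableC.
  by rewrite probability_setC// XY1 subee.
have XY0 : P (~` [set w | X w = Y w]) = 0%E.
  by apply/(negligibleP P (measurableC mXY)).
have := probability_setC P mXY => /=; rewrite XY0 => /esym/eqP.
by rewrite sube_eq// add0e => /eqP.
Qed.

End second_moments.

Section sheet_law.
Context {d : measure_display} {T : measurableType d} {R : realType}.
Context {P : probability T R} {n : nat}.
Implicit Types (X Z : 'rV[R]_n -> {RV P >-> R}) (s t : 'rV[R]_n).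

(** The part of the definition of a Brownian sheet that only depends on the
    finite-dimensional distributions, hence is shared by all modifications. *)
Definition sheet_law Z := let K := @unit_cube R n in
  [/\ gaussian_field K Z,
      (forall s, K s -> 'E_P[Z s]%E = 0%E) &
      (forall s t, K s -> K t ->
        'E_P[(fun w => Z s w * Z t w)%R]%E =
        (\prod_(i < n) Num.min (s ord0 i) (t ord0 i))%:E)].

Lemma sheet_law_modification X Z :
  (forall t, unit_cube t -> {ae P, forall w, X t w = Z t w}) ->
  sheet_law Z -> sheet_law X.
Proof.
move=> XZ [Zg Zm Zc]; split.
- move=> k t c tK; apply: gaussian_var_ae (Zg k t c tK).
    by apply: measurable_sum => j; apply: measurable_funM.
  have : {ae P, forall w, forall j, X (t j) w = Z (t j) w}.
    by apply: filter_forall => j; exact: XZ.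
  by apply: filterS => w XZw; apply: eq_bigr => j _; rewrite XZw.
- by move=> s Ks; rewrite -(Zm s Ks); apply: expectation_ae => //; exact: XZ.
- move=> s t Ks Kt; rewrite -(Zc s t Ks Kt).
  apply: expectation_ae; [exact: measurable_funM|exact: measurable_funM|].
  by have := XZ s Ks; have := XZ t Kt; apply: filterS2 => w -> ->.
Qed.

End sheet_law.

(** * Rounding down, and summable events *)

Section grid.
Context {R : realType}.
Implicit Types (x : R) (m k : nat).

(** In base 16 the deviations [4^-m] of the increments stay far below the
    summable thresholds [2^-m], and no square root is needed to say so. *)
Definition floor16 m x : R := (Num.truncn (16 ^+ m * x))%:R / 16 ^+ m.

Lemma exp16_gt0 m : (0 : R) < 16 ^+ m. Proof. by rewrite exprn_gt0. Qed.

Lemma floor16_itv m x : 0 <= x -> 0 <= x - floor16 m x < (16 ^+ m)^-1.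
Proof.
move=> x0; have e0 := exp16_gt0 m.
have /andP[h1 h2] := truncn_itv (mulr_ge0 (ltW e0) x0).
rewrite /floor16; set j := Num.truncn _ in h1 h2 *.
rewrite subr_ge0 ltrBlDr ler_pdivrMr// mulrC h1/=.
have -> : (16 ^+ m)^-1 + j%:R / 16 ^+ m = j.+1%:R / 16 ^+ m :> R.
  by rewrite -[in RHS]natr1 mulrDl mul1r addrC.
by rewrite ltr_pdivlMr// mulrC.
Qed.

Lemma floor16_ge0 m x : 0 <= floor16 m x.
Proof. by rewrite divr_ge0// ltW ?exp16_gt0. Qed.

Lemma floor16_le1 m x : 0 <= x -> x <= 1 -> floor16 m x <= 1.
Proof.
move=> x0 /(le_trans _); apply; have /andP[] := floor16_itv m x0.
by rewrite subr_ge0.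
Qed.

(** Consistency of the rounding at successive levels: it reduces the increments
    along the approximations of an arbitrary point to increments between grid
    points, of which there are finitely many at each level. *)
Lemma floor16K m k x : (m <= k)%N -> 0 <= x ->
  floor16 m (floor16 k x) = floor16 m x.
Proof.
move=> mk x0; rewrite /floor16; congr (_%:R / _).
have em := exp16_gt0 m; have ek := exp16_gt0 k.
have mx0 : 0 <= 16 ^+ m * x by rewrite mulr_ge0// ltW.
set j := Num.truncn (16 ^+ m * x); set N := Num.truncn (16 ^+ k * x).
have /andP[j1 j2] : j%:R <= 16 ^+ m * x < j.+1%:R by exact: truncn_itv.
have /andP[N1 N2] : N%:R <= 16 ^+ k * x < N.+1%:R.
  by apply: truncn_itv; rewrite mulr_ge0// ltW.
have ekm : 16 ^+ k = 16 ^+ (k - m) * 16 ^+ m :> R by rewrite -exprD subnK.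
have eN : 16 ^+ (k - m) = (16 ^ (k - m))%:R :> R by rewrite natrX.
have e0 := exp16_gt0 (k - m).
have jN : 16 ^+ (k - m) * j%:R <= N%:R :> R.
  rewrite eN -natrM ler_nat truncn_ge_nat; last by rewrite mulr_ge0// ltW.
  by rewrite natrM -eN ekm -mulrA ler_wpM2l// ltW.
have -> : 16 ^+ m * (N%:R / 16 ^+ k) = N%:R / 16 ^+ (k - m) :> R.
  rewrite ekm invfM mulrCA; congr (_ * _).
  by rewrite mulrCA divff ?mulr1 ?gt_eqF.
apply: truncn_def; rewrite ler_pdivlMr// mulrC jN ltr_pdivrMr//=.
by rewrite (le_lt_trans N1)// ekm -mulrA mulrC ltr_pM2r.
Qed.

Lemma floor16_floor16 m k x : (m <= k)%N -> 0 <= x ->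
  floor16 k (floor16 m x) = floor16 m x.
Proof.
move=> mk x0; rewrite /floor16; set j := Num.truncn (16 ^+ m * x).
have ek : 16 ^+ k = 16 ^+ (k - m) * 16 ^+ m :> R by rewrite -exprD subnK.
have jE : 16 ^+ k * (j%:R / 16 ^+ m) = (16 ^ (k - m) * j)%:R :> R.
  rewrite natrM natrX ek mulrACA divff ?mulr1// gt_eqF// exp16_gt0.
rewrite jE natrK -jE mulrAC divff ?mul1r// gt_eqF// exp16_gt0.
Qed.

End grid.

Lemma cvgn_geometric_increments (R : realType) (u : R ^nat) (M : nat) :
  (forall m, (M <= m)%N -> `|u m.+1 - u m| <= 2^-1 ^+ m) -> cvgn u.
Proof.
move=> hu; pose v m := u (m + M)%N.
suff : cvgn v by move=> /cvg_ex[l]; rewrite cvg_shiftn => /cvgP.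
have -> : v = fun m => v 0%N + series (telescope v) m.
  by apply/funext => m; rewrite -eq_sum_telescope.
apply: is_cvgD; first exact: is_cvg_cst.
apply: normed_cvg.
apply: (@series_le_cvg _ _ (geometric 1 2^-1)).
- by move=> m; rewrite normr_ge0.
- by move=> m; rewrite geometric_ge0.
- move=> m /=; rewrite mul1r.
  apply: (le_trans (hu _ (leq_addl m M))).
  by rewrite ler_wiXn2l ?leq_addr//; lra.
- by apply: is_cvg_geometric_series; rewrite ger0_norm; lra.
Qed.

Section borel_cantelli.
Context {d : measure_display} {T : measurableType d} {R : realType}.
Variable P : probability T R.

Lemma lim_sup_set_geometric (A : nat -> set T) (D : R) :
  (forall m, measurable (A m)) ->
  (forall m, (P (A m) <= (D * 4^-1 ^+ m)%:E)%E) -> P (lim_sup_set A) = 0%E.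
Proof.
move=> mA PA; apply: lim_sup_set_cvg0 => //.
apply: (@le_lt_trans _ _ (\sum_(m <oo) (geometric D 4^-1 m)%:E)%E).
  by apply: lee_nneseries => m // _; exact: PA.
have : eseries (EFin \o geometric D 4^-1) @ \oo --> (D / (1 - 4^-1))%:E.
  have -> : eseries (EFin \o geometric D 4^-1) =
      EFin \o series (geometric D 4^-1).
    by apply/funext => m; rewrite /eseries/= sumEFin.
  apply: cvg_EFin; first exact: nearW.
  by apply: cvg_geometric_series; rewrite ger0_norm; lra.
by move/cvg_lim => -> //; rewrite ltry.
Qed.

Lemma probability_bigsetU_le (I : Type) (r : seq I) (A : I -> set T) (b : R) :
  (forall i, measurable (A i)) -> (forall i, (P (A i) <= b%:E)%E) ->
  (P (\big[setU/set0]_(i <- r) A i) <= (b *+ size r)%:E)%E.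
Proof.
move=> mA PA; elim: r => [|i r ih]; first by rewrite big_nil measure0 mulr0n.
rewrite big_cons/= mulrS EFinD; apply: le_trans (leeD (PA i) ih).
by apply: measureU2 => //; exact: bigsetU_measurable.
Qed.

Lemma lim_sup_setN (A : nat -> set T) w : ~ lim_sup_set A w ->
  exists M, forall m, (M <= m)%N -> ~ A m w.
Proof.
move=> nA; apply: contrapT => h; apply: nA => M _.
apply: contrapT => h'; apply: h; exists M => m Mm Am; apply: h'.
by exists m.
Qed.

End borel_cantelli.

(** * Increments of a field with the law of the sheet *)

(** Telescoping: changing the factors one at a time costs at most their
    difference, as all other factors lie in the unit interval. *)
Lemma prodrB_le_sum (R : realDomainType) (I : Type) (r : seq I) (a b : I -> R) :
  (forall i, [/\ 0 <= b i, b i <= a i & a i <= 1]) ->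
  \prod_(i <- r) a i - \prod_(i <- r) b i <= \sum_(i <- r) (a i - b i).
Proof.
move=> ab; elim: r => [|i r ih]; first by rewrite !big_nil subrr.
rewrite !big_cons; case: (ab i) => b0 ba a1.
have p0 : 0 <= \prod_(j <- r) b j by apply: prodr_ge0 => j _; case: (ab j).
have p1 : \prod_(j <- r) b j <= 1.
  apply: prodr_ile1 => j _; case: (ab j) => h1 h2 /(le_trans h2) ->.
  by rewrite h1.
have pa : \prod_(j <- r) b j <= \prod_(j <- r) a j.
  by apply: ler_prod => j _; case: (ab j) => -> ->.
move: ih p0 p1 pa; set A := \prod_(j <- r) a j; set B := \prod_(j <- r) b j.
move=> ih p0 p1 pa.
have -> : a i * A - b i * B = a i * (A - B) + (a i - b i) * B by ring.
rewrite addrC lerD//; first by rewrite ler_piMr// subr_ge0.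
by rewrite (le_trans _ ih)// ler_piMl// ?subr_ge0// (le_trans b0).
Qed.

Section increments.
Context {d : measure_display} {T : measurableType d} {R : realType}.
Context {P : probability T R} {n : nat}.
Variable Z : 'rV[R]_n -> {RV P >-> R}.
Hypothesis lawZ : sheet_law Z.
Implicit Types s t : 'rV[R]_n.

Lemma sheet_increment_gaussian s t : unit_cube s -> unit_cube t ->
  gaussian_var P (Z t \- Z s).
Proof.
move=> Ks Kt; case: lawZ => gZ _ _.
have := gZ 2 (fun j => if j == 0 then t else s)
  (fun j => if j == 0 then 1 else -1).
have -> : (fun w => \sum_(j < 2) (if j == 0 then 1 else -1) *
   Z (if j == 0 then t else s) w) = (Z t \- Z s).
  by apply/funext => w; rewrite !big_ord_recl big_ord0/= mul1r mulN1r addr0.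
by apply => j; case: ifP.
Qed.

(** For [s <= t] all the minima are attained by [s], so the second moment of the
    increment is the difference of the volumes below [t] and below [s]. *)
Lemma sheet_increment_moment s t (e : R) : unit_cube s -> unit_cube t ->
  (forall i, 0 <= t ord0 i - s ord0 i <= e) ->
  ('E_P[(fun w => (Z t \- Z s) w * (Z t \- Z s) w)%R] <= (e *+ n)%:E)%E.
Proof.
move=> Ks Kt st; case: lawZ => _ _ cZ.
rewrite (second_momentB (cZ t t Kt Kt) (cZ t s Kt Ks) (cZ s s Ks Ks)) lee_fin.
under eq_bigr do rewrite minxx.
under [X in 2 * X]eq_bigr => i _.
  rewrite min_r; last by case/andP: (st i); rewrite subr_ge0. over.
under [X in _ + X]eq_bigr do rewrite minxx.
set A := \prod_(i < n) _; set B := \prod_(i < n) _.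
have -> : A - 2 * B + B = A - B by ring.
rewrite /A /B; apply: (le_trans (prodrB_le_sum _ _)).
  move=> i; case/andP: (st i); rewrite subr_ge0 => -> _.
  by case/andP: (Ks i) => -> _; case/andP: (Kt i) => _ ->.
rewrite -[leRHS]mulr_natr -[n in leRHS]card_ord mulr_natr -sumr_const.
by apply: ler_sum => i _; case/andP: (st i).
Qed.

(** The mesh [16^-m] bounds the standard deviation by [n * 4^-m], far below the
    threshold [2^-m]; each unit of [k] gains a factor [4^-m]. *)
Lemma sheet_increment_tail k m s t : (0 < n)%N -> unit_cube s -> unit_cube t ->
  (forall i, 0 <= t ord0 i - s ord0 i <= (16 ^+ m)^-1) ->
  (P [set w | (2^-1 ^+ m <= `|Z t w - Z s w|)%R] <=
   (2 * 256 ^+ k * k`!%:R * n%:R ^+ (2 * k) * (4^-1 ^+ k) ^+ m)%:E)%E.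
Proof.
move=> n0 Ks Kt st; pose q : R := n%:R * 4^-1 ^+ m.
have q0 : 0 < q by rewrite mulr_gt0 ?ltr0n ?exprn_gt0.
have x0 : 0 < 2^-1 ^+ m :> R by rewrite exprn_gt0.
have := @gaussian_tail _ _ _ P (Z t \- Z s)%R q _ k
  (sheet_increment_gaussian Ks Kt) q0 x0.
have -> : q / 2^-1 ^+ m = n%:R * 2^-1 ^+ m.
  rewrite /q -mulrA; congr (_ * _); rewrite -exprVn -exprMn; congr (_ ^+ _).
  by lra.
move=> tail; apply: (le_trans (tail _)).
  apply: le_trans (sheet_increment_moment Ks Kt st) _.
  rewrite lee_fin /q exprMn -exprM mulnC exprM -[leLHS]mulr_natl.
  have -> : 4^-1 ^+ 2 = 16^-1 :> R by rewrite expr2; lra.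
  by rewrite exprVn ler_wpM2r ?invr_ge0 ?exprn_ge0// ler_eXnr// ler1n.
rewrite lee_fin exprMn mulrA le_eqVlt; apply/orP; left; apply/eqP.
congr (_ * _); have -> : 4^-1 = 2^-1 ^+ 2 :> R by rewrite expr2; lra.
by rewrite -!exprM; congr (_ ^+ _); rewrite mulnC mulnA.
Qed.

End increments.

(** * Grids in the unit cube *)

Section multigrid.
Context {R : realType} {n : nat}.
Implicit Types (t : 'rV[R]_n) (m k : nat).

Definition grid_floor m t : 'rV[R]_n := \row_i floor16 m (t ord0 i).

Definition grid_point m (f : {ffun 'I_n -> 'I_(16 ^ m).+1}) : 'rV[R]_n :=
  \row_i ((f i)%:R / 16 ^+ m).

Lemma grid_floor_cube m t : unit_cube t -> unit_cube (grid_floor m t).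
Proof.
move=> Kt i; have /andP[t0 t1] := Kt i.
by rewrite mxE floor16_ge0 floor16_le1.
Qed.

Lemma grid_floor_itv m t i : unit_cube t ->
  0 <= t ord0 i - grid_floor m t ord0 i <= (16 ^+ m)^-1.
Proof.
move=> Kt; have /andP[t0 _] := Kt i; rewrite mxE.
by have /andP[-> /ltW] := floor16_itv m t0.
Qed.

Lemma grid_point_cube m (f : {ffun 'I_n -> 'I_(16 ^ m).+1}) :
  unit_cube (grid_point f).
Proof.
move=> i; rewrite mxE divr_ge0 ?exprn_ge0//= ler_pdivrMr ?exp16_gt0// mul1r.
by rewrite -natrX ler_nat -ltnS.
Qed.

Lemma grid_floor_point m t : unit_cube t ->
  exists f, grid_floor m t = @grid_point m f.
Proof.
move=> Kt.
exists [ffun i => inord (Num.truncn (16 ^+ m * t ord0 i))].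
apply/rowP => i; rewrite !mxE ffunE inordK//.
have /andP[t0 t1] := Kt i.
rewrite truncn_lt_nat ?mulr_ge0 ?exprn_ge0//.
rewrite -[ltRHS]natr1 natrX ltr_pwDr//.
by rewrite ler_piMr// exprn_ge0.
Qed.

Lemma grid_floorK m k t : (m <= k)%N -> unit_cube t ->
  grid_floor m (grid_floor k t) = grid_floor m t.
Proof.
move=> mk Kt; apply/rowP => i; rewrite !mxE floor16K//.
by case/andP: (Kt i).
Qed.

Lemma grid_floor_grid_floor m k t : (m <= k)%N -> unit_cube t ->
  grid_floor k (grid_floor m t) = grid_floor m t.
Proof.
move=> mk Kt; apply/rowP => i; rewrite !mxE floor16_floor16//.
by case/andP: (Kt i).
Qed.

Lemma cvg_grid_floor t : unit_cube t -> grid_floor m t @[m --> \oo] --> t.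
Proof.
move=> Kt; apply/cvg_ballP => e e0.
have : (geometric 1 16^-1 : R ^nat) @ \oo --> 0.
  by apply: cvg_geometric; rewrite ger0_norm; lra.
move=> /cvgr0_norm_lt /(_ e e0); apply: filterS => m.
rewrite /= mul1r ger0_norm ?exprn_ge0//= => me; split => // i j.
rewrite (ord1 i) /ball/= ger0_norm; last first.
  by case/andP: (grid_floor_itv m j Kt).
by apply: le_lt_trans me; rewrite exprVn; case/andP: (grid_floor_itv m j Kt).
Qed.

Lemma grid_points_countable :
  countable (\bigcup_m (range (@grid_point m))).
Proof.
apply: bigcup_countable => // m _; apply: finite_set_countable.
exact: finite_image.
Qed.

End multigrid.

(** * The separable modification *)

Section version.
Context {d : measure_display} {T : measurableType d} {R : realType}.
Context {P : probability T R} {n : nat}.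
Variable Z : 'rV[R]_n -> {RV P >-> R}.
Hypothesis n_gt0 : (0 < n)%N.
Hypothesis lawZ : sheet_law Z.
Implicit Types (s t : 'rV[R]_n) (m k : nat).

Definition jump m s t : set T :=
  [set w | (2^-1 ^+ m <= `|Z t w - Z s w|)%R].

Lemma measurable_jump m s t : measurable (jump m s t).
Proof.
rewrite (_ : jump m s t = (fun w => `|(Z t \- Z s) w|) @^-1` `[2^-1 ^+ m, +oo[).
  by rewrite -[_ @^-1` _]setTI; apply: measurableT_comp.
by apply/seteqP; split => w; rewrite /jump /= in_itv/= andbT.
Qed.

(** A finite union of events, which makes the almost sure statement below
    uniform in the uncountably many points of the cube. *)
Definition grid_jump m : set T :=
  \big[setU/set0]_(f : {ffun 'I_n -> 'I_(16 ^ m.+1).+1})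
    jump m (grid_floor m (grid_point f)) (grid_point f).

Lemma measurable_grid_jump m : measurable (grid_jump m).
Proof. by apply: bigsetU_measurable => f _; exact: measurable_jump. Qed.

Definition exceptional := lim_sup_set grid_jump.

Lemma measurable_exceptional : measurable exceptional.
Proof.
apply: bigcap_measurable => // k _.
by apply: bigcup_measurable => m _; exact: measurable_grid_jump.
Qed.

(** At most [(17 * 16^m)^n] points compete, and [k = 2 n + 1] is the exponent
    for which [16^(n m) * 4^(- k m)] is [4^-m]. *)
Lemma exceptional_null : P exceptional = 0%E.
Proof.
pose k := (2 * n).+1.
pose c : R := 2 * 256 ^+ k * k`!%:R * n%:R ^+ (2 * k).
have c0 : 0 <= c by rewrite /c !mulr_ge0 ?exprn_ge0.
apply: (lim_sup_set_geometric (D := 17 ^+ n * c)) measurable_grid_jump _ => m.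
apply: le_trans (probability_bigsetU_le _ (b := c * (4^-1 ^+ k) ^+ m) _ _) _.
- by move=> f; exact: measurable_jump.
- move=> f; apply: sheet_increment_tail => //.
  + by apply: grid_floor_cube; exact: grid_point_cube.
  + exact: grid_point_cube.
  + by move=> i; apply: grid_floor_itv; exact: grid_point_cube.
have -> : size (index_enum {ffun 'I_n -> 'I_(16 ^ m.+1).+1}) =
    ((16 ^ m.+1).+1 ^ n)%N.
  rewrite -sum1_size -[in RHS](card_ord n) -[in RHS](card_ord (16 ^ m.+1).+1).
  by rewrite -card_ffun -sum1_card; apply: eq_bigl.
rewrite lee_fin -[leLHS]mulr_natl natrX.
have e0 : 0 <= (4^-1 ^+ k) ^+ m :> R by rewrite !exprn_ge0.
apply: (@le_trans _ _ ((17 * 16 ^+ m) ^+ n * (c * (4^-1 ^+ k) ^+ m))).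
  rewrite ler_wpM2r ?mulr_ge0// lerXn2r ?nnegrE ?mulr_ge0 ?exprn_ge0//.
  rewrite -natr1 natrX exprS.
  have : 1 <= 16 ^+ m :> R by rewrite exprn_ege1//; lra.
  lra.
have cancel16 : (16 ^+ m) ^+ n * (4^-1 ^+ k) ^+ m = 4^-1 ^+ m :> R.
  rewrite -!exprM.
  have -> : (k * m = 2 * (m * n) + m)%N by rewrite /k; lia.
  rewrite exprD mulrA [4^-1 ^+ (2 * _)]exprM -exprMn.
  have -> : 16 * 4^-1 ^+ 2 = 1 :> R by rewrite expr2; lra.
  by rewrite expr1n mul1r.
rewrite -cancel16 exprMn le_eqVlt; apply/orP; left; apply/eqP.
clearbody c; rewrite -!mulrA; congr (_ * _).
by rewrite mulrCA.
Qed.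

Lemma cvg_grid_floor_path w t : ~ exceptional w -> unit_cube t ->
  cvgn (fun m => Z (grid_floor m t) w).
Proof.
move=> /lim_sup_setN[M hM] Kt.
apply: (cvgn_geometric_increments (M := M)) => m /hM nm.
rewrite leNgt; apply/negP => /ltW jm; apply: nm.
have [f ft] := grid_floor_point m.+1 Kt.
rewrite /grid_jump -bigcup_seq; exists f; first by rewrite /= mem_index_enum.
by rewrite /jump/= -ft grid_floorK.
Qed.

(** At a single point Borel-Cantelli already works with the exponent [k = 1]. *)
Lemma grid_floor_path_ae t : unit_cube t ->
  {ae P, forall w, Z (grid_floor m t) w @[m --> \oo] --> Z t w}.
Proof.
move=> Kt; pose A m := jump m (grid_floor m t) t.
have mA m : measurable (A m) by exact: measurable_jump.
have A0 : P (lim_sup_set A) = 0%E.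
  apply: (lim_sup_set_geometric mA) => m.
  rewrite -[4^-1]expr1; apply: sheet_increment_tail => //.
  - exact: grid_floor_cube.
  - by move=> i; exact: grid_floor_itv.
exists (lim_sup_set A); split => //.
  apply: bigcap_measurable => // k _.
  by apply: bigcup_measurable.
move=> w; apply: contra_notP => /lim_sup_setN[M hM].
apply/cvgrPdist_le => e e0.
have : (geometric 1 2^-1 : R ^nat) @ \oo --> 0.
  by apply: cvg_geometric; rewrite ger0_norm; lra.
move=> /cvgr0_norm_lt /(_ e e0) he; near=> m.
have Mm : (M <= m)%N by near: m; exists M.
have : `|geometric 1 2^-1 m| < e by near: m.
rewrite /= mul1r ger0_norm ?exprn_ge0//= => me.
rewrite leNgt; apply/negP => em; apply: (hM m Mm).
by rewrite /A /jump/=; apply: le_trans (ltW em); exact: ltW.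
Unshelve. all: by end_near. Qed.

(** The factor makes the sequence converge at every outcome, so that its limit
    is measurable although the probability space may not be complete. *)
Definition path_approx m t w : R :=
  Z (grid_floor m t) w * \1_(~` exceptional) w.

Lemma cvg_path_approx w t : unit_cube t -> cvgn (fun m => path_approx m t w).
Proof.
move=> Kt; rewrite /path_approx; have [Nw|Nw] := pselect (exceptional w).
  rewrite indicE memNset; last by move/(_ Nw).
  by under eq_fun do rewrite mulr0; exact: is_cvg_cst.
by apply: is_cvgMl; exact: cvg_grid_floor_path.
Qed.

Lemma version_exists : exists X : 'rV[R]_n -> {RV P >-> R},
  forall t, unit_cube t -> forall w,
    path_approx m t w @[m --> \oo] --> X t w.
Proof.
suff /choice[X hX] : forall t, exists X : {RV P >-> R}, unit_cube t ->
    forall w, path_approx m t w @[m --> \oo] --> X w.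
  by exists X.
move=> t; have [Kt|Kt] := pselect (unit_cube t); last by exists (cst 0).
have mX : measurable_fun [set: T] (fun w => limn (fun m => path_approx m t w)).
  apply: (@measurable_fun_cvg _ _ _ _ (fun m w => path_approx m t w)).
    move=> m; apply: measurable_funM => //; apply: measurable_indic.
    by apply: measurableC; exact: measurable_exceptional.
  by move=> w _; exact: cvg_path_approx.
exists (mfun_Sub (mem_set mX)) => _ w.
exact: cvg_path_approx.
Qed.

(** The grid points are a separating set.  At one of them the approximations are
    eventually constant, so [X] and [Z] agree there off the exceptional set, and
    convergence of [Z] along the grid is convergence of [X] along the grid. *)
Lemma brownian_version :
  (forall s, unit_cube s -> \prod_(i < n) s ord0 i = 0 ->
    forall w, Z s w = 0) ->
  exists X : 'rV[R]_n -> {RV P >-> R}, brownian_sheet X /\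
    forall t, unit_cube t -> {ae P, forall w, X t w = Z t w}.
Proof.
move=> Z0; have [X hX] := version_exists; exists X.
have Xgrid m t w : unit_cube t -> ~ exceptional w ->
    X (grid_floor m t) w = Z (grid_floor m t) w.
  move=> Kt Nw; have := hX _ (grid_floor_cube m Kt) w.
  move/cvg_unique; apply => //; rewrite /path_approx.
  apply: cvg_near_cst; near=> k.
  rewrite indicE mem_set// mulr1 grid_floor_grid_floor//.
  by near: k; exists m.
have XZ t : unit_cube t -> {ae P, forall w, X t w = Z t w}.
  move=> Kt; have : {ae P, forall w, ~ exceptional w}.
    exists exceptional; split;
      [exact: measurable_exceptional|exact: exceptional_null|].
    by move=> w /contrapT.
  have := grid_floor_path_ae Kt; apply: filterS2 => w Zt Nw.
  have := hX t Kt w; rewrite /path_approx indicE mem_set//.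
  under eq_fun do rewrite mulr1.
  by move/cvg_unique; apply.
split=> //; have [gX mX cX] := sheet_law_modification XZ lawZ.
split=> //.
- pose S : set 'rV[R]_n := \bigcup_m (range (@grid_point R n m)).
  have gS m t : unit_cube t -> S (grid_floor m t).
    by move=> /(grid_floor_point m)[f ->]; exists m => //; exists f.
  exists S, exceptional; split.
  + exact: grid_points_countable.
  + by move=> _ [m _ [f _ <-]]; exact: grid_point_cube.
  + move=> t Kt B tB.
    have [m Bm] := @filter_ex _ _ _ (fun m => B (grid_floor m t))
      (cvg_grid_floor Kt tB).
    by exists (grid_floor m t); split=> //; exact: gS.
  + exists exceptional; split => //;
      [exact: measurable_exceptional|exact: exceptional_null].
  move=> w Nw G F oG cF FS t [Gt Kt].
  have cvgX : X (grid_floor m t) w @[m --> \oo] --> X t w.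
    have := hX t Kt w; apply: cvg_trans; apply: near_eq_cvg; near=> m.
    by rewrite /path_approx indicE mem_set// mulr1 Xgrid.
  apply: (closed_cvg _ cF _ _ cvgX).
  have nG : nbhs t G by apply: open_nbhs_nbhs.
  have : \forall m \near \oo, G (grid_floor m t) := cvg_grid_floor Kt nG.
  apply: filterS => m Gm; apply: FS.
  by split => //; exact: gS.
- move=> s Ks s0 w; apply: (cvg_unique _ (hX s Ks w)) => //.
  suff -> : (fun m => path_approx m s w) = cst 0 by exact: cvg_cst.
  apply/funext => m; rewrite /path_approx Z0 ?mul0r//.
    exact: grid_floor_cube.
  have /eqP/prodf_eq0 [i _ /eqP si] := s0.
  rewrite (bigD1 i)//= mxE si /floor16 mulr0 truncn0 mul0r mul0r//.
Unshelve. all: by end_near. Qed.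

End version.

(** * Vanishing on the boundary, and the change of time *)

Section boundary.
Context {d : measure_display} {T : measurableType d} {R : realType}.
Context {P : probability T R}.

Lemma second_moment0_ae (X : {RV P >-> R}) :
  'E_P[(fun w => X w * X w)%R]%E = 0%E -> {ae P, forall w, X w = 0}.
Proof.
move=> X0.
have : ae_eq P [set: T] (fun w => (X w * X w)%:E) (cst 0%E).
  apply/ae_eq_integral_abs => //.
    by apply/measurable_EFinP; apply: measurable_funM.
  rewrite -[RHS]X0 unlock; apply: eq_integral => w _ /=.
  by rewrite ger0_norm// -expr2 sqr_ge0.
apply: filterS => w /(_ Logic.I)/eqP; rewrite /cst eqe -expr2 sqrf_eq0.
by move/eqP.
Qed.

(** On the hyperplanes [Z] is only almost surely 0; replacing it by 0 there is
    a modification and supplies the boundary hypothesis of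
    [brownian_version]. *)
Lemma brownian_sheet_modification (n : nat) (Z : 'rV[R]_n -> {RV P >-> R}) :
  (0 < n)%N -> sheet_law Z ->
  exists X : 'rV[R]_n -> {RV P >-> R}, brownian_sheet X /\
    forall t, unit_cube t -> {ae P, forall w, X t w = Z t w}.
Proof.
move=> n0 lawZ.
pose zero : {RV P >-> R} := cst 0.
pose Z0 (s : 'rV[R]_n) := if \prod_(i < n) s ord0 i == 0 then zero else Z s.
have Z0Z t : unit_cube t -> {ae P, forall w, Z0 t w = Z t w}.
  move=> Kt; rewrite /Z0; case: eqP => [t0|_]; last exact: aeW.
  have : {ae P, forall w, Z t w = 0}.
    apply: second_moment0_ae; case: lawZ => _ _ ->//.
    by under eq_bigr do rewrite minxx; rewrite t0.
  by apply: filterS => w ->.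
have [|X [BX XZ0]] := brownian_version n0 (sheet_law_modification Z0Z lawZ).
  by move=> s Ks s0 w; rewrite /Z0 s0 eqxx.
exists X; split => // t Kt.
by have := Z0Z t Kt; have := XZ0 t Kt; apply: filterS2 => w -> ->.
Qed.

End boundary.

Section time_change.
Context {R : realType}.
Variables (u v a : R -> R).
Hypothesis v_neq0 : forall x, 0 <= x -> v x != 0.
Hypothesis a_def : forall x, 0 <= x -> a x = u x / v x.
Hypothesis a_incr : forall x y, 0 <= x -> x < y -> a x < a y.
Hypothesis a_range : `[0, 1] `<=` a @` `[0, +oo[.

Lemma inverse_nonnegP y : 0 <= y <= 1 ->
  0 <= inverse_nonneg a y /\ a (inverse_nonneg a y) = y.
Proof.
move=> y01.
have ay : y \in a @` `[0, +oo[ by apply/mem_set/a_range; rewrite /= in_itv.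
split; last exact: pinvK.
have := surjpinv_image_sub (dflt := fun=> 0) a_range.
move=> /(_ (inverse_nonneg a y)); rewrite /= !in_itv/= andbT; apply.
by exists y; rewrite //= in_itv.
Qed.

(** One factor of the covariance: the larger point contributes only [v], which
    the normalization cancels, and the smaller one leaves [u / v]. *)
Lemma transformed_covariance x y : 0 <= x -> 0 <= y ->
  u (Num.min x y) * v (Num.max x y) / v x / v y = Num.min (a x) (a y).
Proof.
wlog xy : x y / x <= y.
  move=> h x0 y0; have /orP[xy|yx] := le_total x y; first exact: h.
  by rewrite minC maxC mulrAC [RHS]minC; exact: h.
move=> x0 y0.
have axy : a x <= a y.
  by move: xy; rewrite le_eqVlt => /orP[/eqP->//|/a_incr-/(_ x0)/ltW].
rewrite !min_l// max_r// a_def// mulrAC mulfK ?v_neq0//.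
Qed.

End time_change.

Lemma transformed_sheet_law (R : realType) (d : measure_display)
    (T : measurableType d) (P : probability T R) (n : nat)
    (Y : 'rV[R]_n -> {RV P >-> R}) (u v a : 'I_n -> R -> R)
    (Y_gaussian : gaussian_field (@orthant R n) Y)
    (Y_mean : forall s, orthant s -> 'E_P[Y s]%E = 0%E)
    (Y_cov : forall s t, orthant s -> orthant t ->
      'E_P[(fun w => Y s w * Y t w)%R]%E =
      (\prod_(i < n) (u i (Num.min (s ord0 i) (t ord0 i)) *
                      v i (Num.max (s ord0 i) (t ord0 i))))%:E)
    (v_neq0 : forall i x, 0 <= x -> v i x != 0)
    (a_def : forall i x, 0 <= x -> a i x = u i x / v i x)
    (a_incr : forall i x y, 0 <= x -> x < y -> a i x < a i y)
    (a_range : forall i, `[0, 1] `<=` a i @` `[0, +oo[)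
    (Z : 'rV[R]_n -> {RV P >-> R})
    (ZE : forall t w, Z t w = transformed_field Y v a t w) : sheet_law Z.
Proof.
pose tau (t : 'rV[R]_n) : 'rV[R]_n := \row_i inverse_nonneg (a i) (t ord0 i).
pose b (t : 'rV[R]_n) :=
  (\prod_(i < n) v i (inverse_nonneg (a i) (t ord0 i)))^-1.
have {}ZE t : (Z t : T -> R) = (fun w => Y (tau t) w * b t).
  by apply/funext => w; rewrite ZE.
have tauK t : unit_cube t -> orthant (tau t).
  by move=> Kt i; rewrite mxE; case: (inverse_nonnegP (a_range i) (Kt i)).
have aK t : unit_cube t ->
    forall i, a i (inverse_nonneg (a i) (t ord0 i)) = t ord0 i.
  by move=> Kt i; case: (inverse_nonnegP (a_range i) (Kt i)).
split.
- move=> k t c Kt.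
  have := Y_gaussian k (tau \o t) (fun j => c j * b (t j)).
  have -> : (fun w => \sum_(j < k) c j * b (t j) * Y ((tau \o t) j) w) =
      (fun w => \sum_(j < k) c j * Z (t j) w).
    apply/funext => w; apply: eq_bigr => j _; rewrite ZE/=; ring.
  by apply => j; exact: tauK.
- move=> s Ks; rewrite ZE.
  rewrite (_ : (fun w => _) = b s \o* Y (tau s))// expectationZl.
    by rewrite Y_mean ?mule0//; exact: tauK.
  exact: (sqr_Lfun1_Lfun1 (Y_cov _ _ (tauK s Ks) (tauK s Ks))).
- move=> s t Ks Kt; rewrite !ZE.
  rewrite (_ : (fun w => _) =
      (b s * b t) \o* (fun w => Y (tau s) w * Y (tau t) w)); last first.
    by apply/funext => w /=; ring.
  rewrite expectationZl; last first.
    exact: (mul_Lfun1 (Y_cov _ _ (tauK s Ks) (tauK s Ks))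
      (Y_cov _ _ (tauK t Kt) (tauK t Kt))).
  rewrite Y_cov; [|exact: tauK|exact: tauK].
  rewrite -EFinM mulrC mulrA /b -!prodfV -!big_split/=; congr (_%:E).
  apply: eq_bigr => i _; rewrite !mxE.
  rewrite (transformed_covariance (a := a i)) ?aK//.
  + exact: v_neq0.
  + exact: a_def.
  + exact: a_incr.
  + by have := tauK s Ks i; rewrite mxE.
  + by have := tauK t Kt i; rewrite mxE.
Qed.

Theorem lemma3p1 (R : realType) (d : measure_display) (T : measurableType d)
    (P : probability T R) (n : nat) (n_gt0 : (0 < n)%N)
    (Y : 'rV[R]_n -> {RV P >-> R}) (u v a : 'I_n -> R -> R)
    (Y_gaussian : gaussian_field (@orthant R n) Y)
    (Y_mean : forall s, orthant s -> 'E_P[Y s]%E = 0%E)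
    (Y_cov : forall s t, orthant s -> orthant t ->
      'E_P[(fun w => Y s w * Y t w)%R]%E =
      (\prod_(i < n) (u i (Num.min (s ord0 i) (t ord0 i)) *
                      v i (Num.max (s ord0 i) (t ord0 i))))%:E)
    (v_neq0 : forall i x, 0 <= x -> v i x != 0)
    (a_def : forall i x, 0 <= x -> a i x = u i x / v i x)
    (a_incr : forall i x y, 0 <= x -> x < y -> a i x < a i y)
    (a_cont : forall i, {within `[0, +oo[, continuous (a i)})
    (a_range : forall i, `[0, 1] `<=` a i @` `[0, +oo[) :
  exists X : 'rV[R]_n -> {RV P >-> R},
    brownian_sheet X /\
    stochastically_equivalent P (@unit_cube R n) (transformed_field Y v a)
      (fun t => X t).
Proof.
have mZ t : measurable_fun [set: T] (transformed_field Y v a t).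
  by apply: measurable_funM.
pose Z t : {RV P >-> R} := mfun_Sub (mem_set (mZ t)).
have lawZ : sheet_law Z.
  exact: (transformed_sheet_law Y_gaussian Y_mean Y_cov v_neq0 a_def a_incr
    a_range).
have [X [BX XZ]] := brownian_sheet_modification n_gt0 lawZ.
exists X; split=> // t Kt; apply/(probability_eq1_ae (Z t) (X t)).
by apply: filterS (XZ t Kt) => w ->.
Qed.
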